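(* Let $K$ be an $\boldsymbol H$-operator valued kernel on $X$ which is $\Gamma$-invariant (where $\mathcal H_{\alpha\cdot x}=\mathcal H_x$ for all $x\in X$ and $\alpha\in\Gamma_{a(x)}$, and $K(\alpha\cdot x,y)=K(x,\alpha^*\cdot y)$ for all $x,y\in X$ and $\alpha\in\Gamma_{a(x)}^{a(y)}$) and partially positive semidefinite with respect to the partition $P_a=\{X_s\}_{s\in S}$. Let $K^s=K|_{X_s\times X_s}$, let $\mathcal R_{K^s}$ be the reproducing kernel Hilbert space of $K^s$, and set $\boldsymbol R=\{\mathcal R_{K^s}\}_{s\in S}$ and $\boldsymbol D=\{\mathcal D_s\}_{s\in S}$ with $\mathcal D_s=\operatorname{Lin}\{K^s_xh\mid x\in X_s,\ h\in\mathcal H_x\}$. Then there exists a unique generalised $*$-representation $(\mathrm{Id}_S,\Phi)$, $\Phi\colon\Gamma\to\Gamma_{\boldsymbol R,\boldsymbol D}$, such that for every $\alpha\in\Gamma$ and every $x\in X_{d(\alpha)}$, $$K^{c(\alpha)}_{\alpha\cdot x}=\Phi(\alpha)K^{d(\alpha)}_x .$$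
   Context: $\mathbb F$ is $\mathbb R$ or $\mathbb C$. $\operatorname{Lin}$ denotes linear span; $\mathcal B(\mathcal H,\mathcal G)$ is the space of bounded linear operators. Semigroupoids. A semigroupoid $(\Gamma;S;d;c;\cdot)$ consists of nonempty sets $\Gamma$ and $S$ (the set of symbols), maps $d,c\colon\Gamma\to S$ (domain and codomain maps), and a product $\alpha\beta\in\Gamma$ defined whenever $d(\alpha)=c(\beta)$ (the set of such pairs is $\Gamma^{(2)}$), with $d(\alpha\beta)=d(\beta)$, $c(\alpha\beta)=c(\alpha)$, and $\alpha(\beta\gamma)=(\alpha\beta)\gamma$ whenever $d(\alpha)=c(\beta)$, $d(\beta)=c(\gamma)$. Put $\Gamma_s=\{\alpha\mid d(\alpha)=s\}$, $\Gamma^t=\{\alpha\mid c(\alpha)=t\}$, $\Gamma_s^t=\Gamma_s\cap\Gamma^t$. A $*$-semigroupoid is a semigroupoid with a map $\alpha\mapsto\alpha^*$ such that $d(\alpha^* )=c(\alpha)$, $c(\alpha^* )=d(\alpha)$, $(\alpha\beta)^*=\beta^*\alpha^*$ for $(\alpha,\beta)\in\Gamma^{(2)}$, and $(\alpha^* )^*=\alpha$. No unit is assumed. A left action $(a;\cdot)$ of $\Gamma$ on a nonempty set $X$ consists of a surjective map $a\colon X\to S$ (the anchor) and, for each $x\in X$ and $\alpha\in\Gamma_{a(x)}$, an element $\alpha\cdot x\in X$ with $a(\alpha\cdot x)=c(\alpha)$, such that $(\alpha\beta)\cdot x=\alpha\cdot(\beta\cdot x)$ for $(\alpha,\beta)\in\Gamma^{(2)}$,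 $\beta\in\Gamma_{a(x)}$. Setting. $\Gamma$ is a $*$-semigroupoid with symbol set $S$, $(a;\cdot)$ is a left action of $\Gamma$ on the nonempty set $X$, $X_s=a^{-1}(\{s\})$, $P_a=\{X_s\}_{s\in S}$. $\boldsymbol H=\{\mathcal H_x\}_{x\in X}$ is a bundle (family) of Hilbert spaces over $\mathbb F$. An $\boldsymbol H$-operator valued kernel $K$ on $X$ is a map on $X\times X$ with $K(x,y)\in\mathcal B(\mathcal H_y,\mathcal H_x)$. $K$ is partially positive semidefinite with respect to $P_a$ if for every $s\in S$, $K(x,y)^*=K(y,x)$ for $x,y\in X_s$, and $\sum_{i,j=1}^n\langle K(x_j,x_i)h_i,h_j\rangle_{\mathcal H_{x_j}}\ge0$ for all $n\in\mathbb N$, $x_1,\dots,x_n\in X_s$, $h_i\in\mathcal H_{x_i}$. Reproducing kernel Hilbert spaces. Let $\boldsymbol H_s=\{\mathcal H_x\}_{x\in X_s}$ and $\mathcal F_{\mathbb F}(X_s;\boldsymbol H_s)=\prod_{x\in X_s}\mathcal H_x$ be the vector space of sections ($f(x)\in\mathcal H_x$). For $x\in X_s$, $h\in\mathcal H_x$, $K^s_xh=K^s(\cdot,x)h$ is a section. $\mathcal R_{K^s}$ is the (unique) Hilbert space which is a linear subspace of $\mathcal F_{\mathbb F}(X_s;\boldsymbol H_s)$, contains all $K^s_xh$, and satisfies $\langle f(x),h\rangle_{\mathcal H_x}=\langle f,K^s_xh\rangle_{\mathcal R_{K^s}}$ for all $f\in\mathcal R_{K^s}$, $x\in X_s$, $h\in\mathcal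 H_x$; it exists since $K^s$ is positive semidefinite, and $\mathcal D_s$ is dense in it. $K^s_x$ is regarded as a linear operator $\mathcal H_x\to\mathcal R_{K^s}$. Generalised representations. For Hilbert spaces $\boldsymbol R=\{\mathcal R_s\}_{s\in S}$ and dense linear subspaces $\mathcal D_s\subseteq\mathcal R_s$, $\mathcal L^*(\mathcal D_s,\mathcal D_t)$ is the vector space of linear operators $T\colon\mathcal D_s\to\mathcal R_t$ with $T\mathcal D_s\subseteq\mathcal D_t$, $\mathcal D_t\subseteq\operatorname{Dom}(T^* )$ and $T^*\mathcal D_t\subseteq\mathcal D_s$ ($T^*$ the possibly unbounded Hilbert space adjoint). $\Gamma_{\boldsymbol R,\boldsymbol D}=\bigsqcup_{s,t\in S}\mathcal L^*(\mathcal D_s,\mathcal D_t)$ is a $*$-semigroupoid with symbol set $S$ under composition, with involution $T\mapsto T^*|_{\mathcal D_t}$. A generalised $*$-representation $(\mathrm{Id}_S,\Phi)$ is a map $\Phi\colon\Gamma\to\Gamma_{\boldsymbol R,\boldsymbol D}$ with $\Phi(\alpha)\in\mathcal L^*(\mathcal D_{d(\alpha)},\mathcal D_{c(\alpha)})$, $\Phi(\alpha\beta)=\Phi(\alpha)\Phi(\beta)$ on $\mathcal D_{d(\beta)}$ for $(\alpha,\beta)\in\Gamma^{(2)}$, and $\Phi(\alpha^* )=\Phi(\alpha)^*$ on $\mathcal D_{c(\alpha)}$. *)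

(* Defs.v *)
From HB Require Import structures.
From mathcomp Require Import all_boot all_order all_algebra.
From mathcomp Require Import sesquilinear.
From mathcomp Require Import complex.
From mathcomp Require Import boolp classical_sets reals.
From mathcomp Require Import topology normedtype.

Set Implicit Arguments.
Unset Strict Implicit.
Unset Printing Implicit Defensive.

Import Order.TTheory GRing.Theory Num.Theory.
Local Open Scope classical_set_scope.
Local Open Scope ring_scope.

Inductive scalar_kind := RealScalars | ComplexScalars.

Definition scalars (R : realType) (k : scalar_kind) : numFieldType :=
  match k with
  | RealScalars => R
  | ComplexScalars => R[i]
  end.

Definition scalar_conj (R : realType) (k : scalar_kind) :
    {rmorphism scalars R k -> scalars R k} :=
  match k return {rmorphism scalars R k -> scalars R k} with
  | RealScalars => (idfun : {rmorphism R -> R})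
  | ComplexScalars => (@conjc R : {rmorphism R[i] -> R[i]})
  end.

(* [{dot V for theta}] is linear in its first argument, conjugate linear in
   the second one, hermitian and positive definite. *)
Record hilbert (R : realType) (k : scalar_kind) := Hilbert {
  hcarrier :> completeNormedModType (scalars R k);
  hdot : {dot hcarrier for scalar_conj R k};
  hnormE : forall v : hcarrier, `|v| ^+ 2 = hdot v v
}.

Notation "'[< u , v >]" := (hdot _ u v)
  (at level 0, format "''[<' u ,  v '>]'").

Record bounded_op (R : realType) (k : scalar_kind) (V W : hilbert R k) :=
  BoundedOp {
    bop_fun :> {linear V -> W};
    bop_bounded : exists M : scalars R k,
      forall v : V, `|bop_fun v| <= M * `|v|
  }.

Definition is_adjoint (R : realType) (k : scalar_kind) (V W : hilbert R k)
    (T : bounded_op V W) (T' : bounded_op W V) : Prop :=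
  forall (v : V) (w : W), '[< T v, w >] = '[< v, T' w >].

Definition hcast (R : realType) (k : scalar_kind) (V W : hilbert R k)
    (e : V = W) : V -> W :=
  match e in _ = W' return V -> W' with erefl => fun v => v end.

Definition lin_span (K : numFieldType) (V : lmodType K) (A : set V) : set V :=
  [set v | exists (n : nat) (c : 'I_n -> K) (u : 'I_n -> V),
     (forall i, A (u i)) /\ v = \sum_(i < n) c i *: u i].

Lemma sub_lin_span (K : numFieldType) (V : lmodType K) (A : set V) :
  A `<=` lin_span A.
Proof.
move=> v Av; exists 1%N, (fun=> 1), (fun=> v); split=> //.
by rewrite big_ord1 scale1r.
Qed.

(* The product is a total function: its value at (x, y) is irrelevant unless
   [dom x = cod y]. *)
Record semigroupoid := Semigroupoid {
  arrow :> Type;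
  symbol : Type;
  arrow_nonempty : inhabited arrow;
  symbol_nonempty : inhabited symbol;
  dom : arrow -> symbol;
  cod : arrow -> symbol;
  mul : arrow -> arrow -> arrow;
  dom_mul : forall x y, dom x = cod y -> dom (mul x y) = dom y;
  cod_mul : forall x y, dom x = cod y -> cod (mul x y) = cod x;
  mul_assoc : forall x y z, dom x = cod y -> dom y = cod z ->
    mul x (mul y z) = mul (mul x y) z
}.

Record star_semigroupoid := StarSemigroupoid {
  ssg :> semigroupoid;
  star : ssg -> ssg;
  dom_star : forall x, dom (star x) = cod x;
  cod_star : forall x, cod (star x) = dom x;
  star_mul : forall x y, dom x = cod y ->
    star (mul x y) = mul (star y) (star x);
  star_star : forall x, star (star x) = x
}.

Record hom (G : semigroupoid) (s t : symbol G) := Hom {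
  hom_val :> G;
  hom_dom : dom hom_val = s;
  hom_cod : cod hom_val = t
}.

Definition hom_of (G : semigroupoid) (x : G) : hom (dom x) (cod x) :=
  Hom (erefl (dom x)) (erefl (cod x)).

Lemma hom_composable (G : semigroupoid) (s t r : symbol G)
  (x : hom t r) (y : hom s t) : dom x = cod y.
Proof. by rewrite (hom_dom x) (hom_cod y). Qed.

Definition hom_mul (G : semigroupoid) (s t r : symbol G)
    (x : hom t r) (y : hom s t) : hom s r :=
  Hom (etrans (dom_mul (hom_composable x y)) (hom_dom y))
      (etrans (cod_mul (hom_composable x y)) (hom_cod x)).

Definition hom_star (G : star_semigroupoid) (s t : symbol G)
    (x : hom s t) : hom t s :=
  Hom (etrans (dom_star x) (hom_cod x)) (etrans (cod_star x) (hom_dom x)).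

(* As for the product, [act g x] is irrelevant unless [dom g = anchor x]. *)
Record left_action (G : semigroupoid) (X : Type) := LeftAction {
  space_nonempty : inhabited X;
  anchor : X -> symbol G;
  anchor_surj : forall s, exists x, anchor x = s;
  act : G -> X -> X;
  anchor_act : forall g x, dom g = anchor x -> anchor (act g x) = cod g;
  act_mul : forall g h x, dom g = cod h -> dom h = anchor x ->
    act (mul g h) x = act g (act h x)
}.

Section Fibres.
Variables (G : semigroupoid) (X : Type) (a : left_action G X).

Definition fibre (s : symbol G) := {x : X | anchor a x = s}.

Lemma fibre_dom s t (g : hom s t) (x : fibre s) : dom g = anchor a (sval x).
Proof. by rewrite (hom_dom g) (svalP x). Qed.

Definition fibre_act s t (g : hom s t) (x : fibre s) : fibre t :=
  exist _ (act a g (sval x))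
    (etrans (anchor_act (fibre_dom g x)) (hom_cod g)).

End Fibres.

Section Kernels.
Variables (R : realType) (k : scalar_kind).

Definition kernel (X : Type) (H : X -> hilbert R k) :=
  forall x y : X, bounded_op (H y) (H x).

Definition kernel_psd (X : Type) (H : X -> hilbert R k) (K : kernel H) : Prop :=
  (forall x y, is_adjoint (K x y) (K y x)) /\
  (forall (n : nat) (x : 'I_n -> X) (h : forall i, H (x i)),
     0 <= \sum_(i < n) \sum_(j < n) '[< K (x j) (x i) (h i), h j >]).

(* A Hilbert space of sections of H is encoded as a Hilbert space with an
   injective linear map [rk_sec] into the product of the H x; [rk_ker h], for [h] in H x, is
   the element whose section is [K _ x h]. *)
Record rkhs (X : Type) (H : X -> hilbert R k) (K : kernel H) := Rkhs {
  rk_space :> hilbert R k;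
  rk_sec : rk_space -> forall x, H x;
  rk_sec_linear : forall (c : scalars R k) (f g : rk_space) (x : X),
    rk_sec (c *: f + g) x = c *: rk_sec f x + rk_sec g x;
  rk_sec_inj : forall f g : rk_space, (forall x, rk_sec f x = rk_sec g x) ->
    f = g;
  rk_ker : forall x, H x -> rk_space;
  rk_kerE : forall (x y : X) (h : H x), rk_sec (rk_ker h) y = K y x h;
  rk_reproducing : forall (f : rk_space) (x : X) (h : H x),
    '[< rk_sec f x, h >] = '[< f, rk_ker h >]
}.

End Kernels.

Arguments rk_sec {R k X H K} r f x.
Arguments rk_ker {R k X H K} r {x} h.

Section KernelSpan.
Variables (R : realType) (k : scalar_kind) (X : Type) (H : X -> hilbert R k).
Variables (K : kernel H) (E : rkhs K).

Definition ker_span : set E :=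
  lin_span [set f : E | exists (x : X) (h : H x), f = rk_ker E h].

Definition ker_in_span (x : X) (h : H x) : {f : E | ker_span f} :=
  exist _ (rk_ker E h)
    (sub_lin_span (ex_intro _ x (ex_intro _ h (erefl (rk_ker E h))))).

(* Adjoints of operators defined on [ker_span] are therefore single valued. *)
Lemma ker_span_total (v : E) :
  (forall u : {f : E | ker_span f}, '[< sval u, v >] = 0) -> v = 0.
Proof.
move=> v_orth.
have sec0 x : rk_sec E 0 x = 0.
  by have := rk_sec_linear (-1) (0 : E) 0 x;
    rewrite scaler0 addr0 scaleN1r addNr.
apply: (rk_sec_inj (r := E)) => x; rewrite sec0.
apply/eqP/negPn/negP => /(neq0_dnorm_gt0 (s := hdot _)).
set h := rk_sec E v x; suff -> : '[< h, h >] = 0 by rewrite ltxx.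
by rewrite rk_reproducing hermC /= (v_orth (ker_in_span h)) rmorph0 mulr0.
Qed.

End KernelSpan.

Arguments ker_span {R k X H K} E _.
Arguments ker_in_span {R k X H K} E {x} h.

Section LStar.
Variables (R : realType) (k : scalar_kind) (V W : hilbert R k).
Variables (D : set V) (E : set W).

(* [w] is in the domain of the adjoint of [T : D -> W] and [T^* w = v]; such a
   [v] is unique when D is dense. *)
Definition adjoint_at (T : {v : V | D v} -> W) (w : W) (v : V) : Prop :=
  forall u : {v : V | D v}, '[< T u, w >] = '[< sval u, v >].

Definition adjoint_dom (T : {v : V | D v} -> W) : set W :=
  [set w | exists v, adjoint_at T w v].

Record Lstar := MkLstar {
  lfun :> {v : V | D v} -> W;
  lfun_linear : forall (c : scalars R k) (u v w : {v : V | D v}),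
    sval w = c *: sval u + sval v -> lfun w = c *: lfun u + lfun v;
  lfun_maps : forall u, E (lfun u);
  lfun_adj_dom : E `<=` adjoint_dom lfun;
  lfun_adj_maps : forall w v, E w -> adjoint_at lfun w v -> D v
}.

Definition lfun_in (T : Lstar) (u : {v : V | D v}) : {w : W | E w} :=
  exist _ (T u) (lfun_maps T u).

End LStar.

Section GeneralisedRepresentations.
Variables (R : realType) (k : scalar_kind) (G : star_semigroupoid).
Variables (E : symbol G -> hilbert R k) (D : forall s, set (E s)).

Definition rep_map := forall g : G, Lstar (@D (dom g)) (@D (cod g)).

Definition lstar_cast s s' t t' (es : s = s') (et : t = t') :
    Lstar (@D s) (@D t) -> Lstar (@D s') (@D t') :=
  match es in _ = u, et in _ = v
    return Lstar (@D s) (@D t) -> Lstar (@D u) (@D v) with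
  | erefl, erefl => fun T => T
  end.

(* [Phi g] regarded as an element of [L^*(D_s, D_t)] when [dom g = s] and
   [cod g = t]. *)
Definition rep_on (Phi : rep_map) s t (g : hom s t) : Lstar (@D s) (@D t) :=
  lstar_cast (hom_dom g) (hom_cod g) (Phi (hom_val g)).

Definition generalised_star_rep (Phi : rep_map) : Prop :=
  (forall s t r (g : hom t r) (h : hom s t) (u : {v : E s | D v}),
     rep_on Phi (hom_mul g h) u = rep_on Phi g (lfun_in (rep_on Phi h) u)) /\
  (forall s t (g : hom s t) (w : {v : E t | D v}),
     adjoint_at (rep_on Phi g) (sval w) (rep_on Phi (hom_star g) w)).

End GeneralisedRepresentations.

Section Invariance.
Variables (R : realType) (k : scalar_kind) (G : star_semigroupoid).
Variables (X : Type) (a : left_action G X) (H : X -> hilbert R k).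

Definition invariant_bundle : Prop :=
  forall (g : G) (x : X), dom g = anchor a x -> H (act a g x) = H x.

Lemma star_dom (g : G) (y : X) :
  cod g = anchor a y -> dom (star g) = anchor a y.
Proof. by rewrite dom_star. Qed.

(* K(g.x, y) = K(x, g^*.y), both sides being regarded as operators from H y to
   H x. *)
Definition invariant_kernel (eqH : invariant_bundle) (K : kernel H) : Prop :=
  forall (x y : X) (g : G) (gx : dom g = anchor a x) (gy : cod g = anchor a y)
    (h : H y),
    hcast (eqH g x gx) (K (act a g x) y h) =
    K x (act a (star g) y) (hcast (esym (eqH (star g) y (star_dom gy))) h).

Definition fibre_bundle (s : symbol G) (x : fibre a s) := H (sval x).

Definition fibre_kernel (K : kernel H) (s : symbol G) :
  kernel (@fibre_bundle s) := fun x y => K (sval x) (sval y).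

Definition partially_psd (K : kernel H) : Prop :=
  forall s, kernel_psd (fibre_kernel K (s := s)).

End Invariance.

Arguments fibre_kernel {R k G X} a {H} K s x y.

(* Main.v *)
Require Import Defs.
From mathcomp Require Import all_boot all_order all_algebra.
From mathcomp Require Import sesquilinear.
From mathcomp Require Import boolp classical_sets reals topology normedtype.

(** The representation is given by translation of sections: for g : s -> t,
    Phi(g) sends a section f over X_s to the section y |-> f(g^* . y) over X_t.
    Invariance says exactly that this takes K_x h to K_(g.x) h, because
    K(g^* . y, x) = K(y, g . x); hence Phi(g) maps D_s into D_t, even though
    translating an arbitrary element of the reproducing kernel space of K^s
    need not give an element of that of K^t.

    Since an element of a reproducing kernel space is determined by its
    section, no choice of a decomposition into kernel elements is involved in
    Phi(g): linearity is that of the translation, and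
    Phi(g h) = Phi(g) Phi(h) is the identity (g h)^* = h^* g^* together with the
    action law, valid for all sections ([pull_mul], [translate_mul]).

    For the adjoint, take u = K_x h in D_s and f' in the space over X_s which is
    the translate, along g, of an element f of the space over X_t.  The
    reproducing property gives
      <f', K_x h> = <f(g . x), h> = <f, K_(g.x) h> = <f, Phi(g) (K_x h)>,
    and by linearity this holds for all u in D_s.  It is proved together with
    the existence of the translates ([translate_exists]); applied to g^*, for
    which f |-> f' is Phi(g), it says that Phi(g^* ) is the restriction of the
    adjoint of Phi(g).  As D_s is total, the adjoint takes no other values on
    D_t, so Phi(g) is in L^*(D_s, D_t).

    Uniqueness: Phi(g) is linear on D_s and prescribed on the vectors K_x h that
    span it ([Lstar_ext_span]). *)

Set Implicit Arguments.
Unset Strict Implicit.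
Unset Printing Implicit Defensive.

Import Order.TTheory GRing.Theory Num.Theory.
Local Open Scope classical_set_scope.
Local Open Scope ring_scope.

(** * Transport along equalities of Hilbert spaces *)

Section Transport.
Variables (R : realType) (k : scalar_kind).
Implicit Types U V W : hilbert R k.

Lemma hcast_linear V W (e : V = W) c (u v : V) :
  hcast e (c *: u + v) = c *: hcast e u + hcast e v.
Proof. by case: W / e. Qed.

Lemma hcast0 V W (e : V = W) : hcast e (0 : V) = 0.
Proof. by case: W / e. Qed.

Lemma hcast_dot V W (e : V = W) (v : V) (w : W) :
  '[< hcast e v, w >] = '[< v, hcast (esym e) w >].
Proof. by case: W / e w. Qed.

Lemma hcast_trans U V W (e : U = V) (e' : V = W) (e'' : U = W) (u : U) :
  hcast e' (hcast e u) = hcast e'' u.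
Proof.
by case: W / e' e''; case: V / e => e''; rewrite (Prop_irrelevance e'' erefl).
Qed.

(** The equality [e] need not be the image of [x = y] under [H]: by proof
    irrelevance every identification of the two spaces acts in the same way.
    The equalities that an invariant bundle provides are arbitrary ones. *)
Lemma hcast_section (X : Type) (H : X -> hilbert R k) (f : forall x, H x)
    (x y : X) (e : H x = H y) :
  x = y -> hcast e (f x) = f y.
Proof.
by move=> xy; case: y / xy e => e; rewrite (Prop_irrelevance e erefl).
Qed.

(** The companion of [hcast_section] for vectors instead of sections, where the
    cast lies under the function. *)
Lemma hcast_arg (X : Type) (H : X -> hilbert R k) (W : Type)
    (F : forall x, H x -> W) V (x y : X) (e : V = H x) (e' : V = H y) (v : V) :
  x = y -> F x (hcast e v) = F y (hcast e' v).
Proof.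
by move=> xy; case: y / xy e' => e'; rewrite (Prop_irrelevance e e').
Qed.

End Transport.

(** * Linear spans and operators defined on them *)

Section LinSpan.
Variables (F : numFieldType) (V : lmodType F) (A : set V).

Lemma lin_span0 : lin_span A 0.
Proof.
exists 0%N, (fun=> 0), (fun=> 0); rewrite big_ord0.
by split=> // -[m].
Qed.

Lemma lin_span_ind (P : set V) :
    P 0 ->
    (forall c a v, A a -> lin_span A v -> P v -> P (c *: a + v)) ->
  lin_span A `<=` P.
Proof.
move=> P0 PD v [n [c [u [Au ->]]]]; elim: n c u Au => [|n IHn] c u Au.
  by rewrite big_ord0.
rewrite big_ord_recl; apply: PD => //; last exact: IHn.
exists n, (c \o lift ord0), (u \o lift ord0); split=> // i; exact: Au.
Qed.

Lemma lin_span_linear c a v : A a -> lin_span A v -> lin_span A (c *: a + v).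
Proof.
move=> Aa [n [d [u [Au ->]]]].
exists n.+1, (fun i => oapp d c (unlift ord0 i)),
  (fun i => oapp u a (unlift ord0 i)).
split=> [i|]; first by case: unliftP => [j|] _ //=; exact: Au.
rewrite big_ord_recl unlift_none; congr (_ + _).
by apply: eq_bigr => i _; rewrite liftK.
Qed.

End LinSpan.

Section Lstar.
Variables (R : realType) (k : scalar_kind) (V W : hilbert R k).
Variables (D : set V) (E : set W).

Lemma Lstar_ext (T T' : Lstar D E) : (forall u, T u = T' u) -> T = T'.
Proof.
case: T T' => [T l m a b] [T' l' m' a' b'] /= /funext TT'.
case: T' / TT' l' m' a' b' => *.
by congr MkLstar; exact: Prop_irrelevance.
Qed.

(** Linearity extends the agreement from generators to their span.  As the domain
    is a subtype, the induction over the span quantifies over the membership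
    proofs. *)
Lemma Lstar_ext_span (A : set V) (T T' : Lstar D E) :
    D = lin_span A ->
    (forall u, A (sval u) -> T u = T' u) ->
  T = T'.
Proof.
move=> DA TT'; apply: Lstar_ext => -[u Du].
have: lin_span A u by rewrite -DA.
suff: lin_span A `<=`
    [set u | forall Du : D u, T (exist _ u Du) = T' (exist _ u Du)].
  by move=> h /h; apply.
move=> {u Du}; apply: lin_span_ind => [D0|c a v Aa Av IH Dav] /=.
  have z (S : Lstar D E) : S (exist _ 0 D0) = 0.
    have := @lfun_linear _ _ _ _ _ _ S (-1) (exist _ 0 D0) (exist _ 0 D0)
      (exist _ 0 D0).
    by rewrite /= scaler0 addr0 scaleN1r addNr; apply.
  by rewrite !z.
have Da : D a by rewrite DA; exact: sub_lin_span.
have Dv : D v by rewrite DA.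
have lin (S : Lstar D E) :
    S (exist _ _ Dav) = c *: S (exist _ a Da) + S (exist _ v Dv).
  exact: lfun_linear.
by rewrite !lin IH TT'.
Qed.

End Lstar.

(** * Totality of the kernel elements *)

Section Rkhs.
Variables (R : realType) (k : scalar_kind) (X : Type) (H : X -> hilbert R k).
Variables (K : kernel H) (E : rkhs K).

Lemma rk_sec0 x : rk_sec E 0 x = 0.
Proof.
by have := rk_sec_linear (-1) (0 : E) 0 x;
  rewrite scaler0 addr0 scaleN1r addNr.
Qed.

Lemma adjoint_at_inj (W : hilbert R k) (T : {f : E | ker_span E f} -> W)
    (w : W) (v v' : E) :
  adjoint_at T w v -> adjoint_at T w v' -> v = v'.
Proof.
move=> Tv Tv'; apply/subr0_eq/ker_span_total => u.
by rewrite linearBr /= -Tv -Tv' subrr.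
Qed.

End Rkhs.

(** * Arrows and fibres *)

Local Notation hom := Defs.hom.

Section Hom.
Variable G : star_semigroupoid.

Lemma hom_inj (s t : symbol G) (g h : hom s t) : g = h :> G -> g = h.
Proof.
case: g h => [g gs gt] [h hs ht] /= gh; case: h / gh hs ht => hs ht.
by rewrite (Prop_irrelevance gs hs) (Prop_irrelevance gt ht).
Qed.

Lemma hom_star_mul (s t r : symbol G) (g : hom t r) (h : hom s t) :
  hom_star (hom_mul g h) = hom_mul (hom_star h) (hom_star g).
Proof. by apply: hom_inj; exact/star_mul/hom_composable. Qed.

Lemma fibre_act_mul (X : Type) (a : left_action G X) (s t r : symbol G)
    (g : hom t r) (h : hom s t) (x : fibre a s) :
  fibre_act (hom_mul g h) x = fibre_act g (fibre_act h x).
Proof.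
apply: eq_exist; apply: act_mul; first exact: hom_composable.
exact: fibre_dom.
Qed.

End Hom.

(** * Translation of sections *)

Section Translation.
Variables (R : realType) (k : scalar_kind) (G : star_semigroupoid).
Variables (X : Type) (a : left_action G X) (H : X -> hilbert R k).
Variables (eqH : invariant_bundle a H).

(** Sections are contravariant in the arrow, which is why the representation is
    [pull (hom_star g)] and not [pull g]. *)
Definition pull s t (g : hom s t) (f : forall y : fibre a t, H (sval y))
    (x : fibre a s) : H (sval x) :=
  hcast (eqH (fibre_dom g x)) (f (fibre_act g x)).

Lemma pull_mul s t r (g : hom t r) (h : hom s t) f x :
  pull (hom_mul g h) f x = pull h (pull g f) x.
Proof.
rewrite /pull.
have e := fibre_act_mul g h x.
have eH : H (sval (fibre_act (hom_mul g h) x)) =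
          H (sval (fibre_act g (fibre_act h x))) by rewrite e.
rewrite -(hcast_section (H := fun y => H (sval y)) f eH e).
have eH' : H (sval (fibre_act (hom_mul g h) x)) = H (sval (fibre_act h x)).
  exact: etrans eH (eqH (fibre_dom g (fibre_act h x))).
rewrite (hcast_trans _ _ eH').
by rewrite (hcast_trans _ _ (eqH (fibre_dom (hom_mul g h) x))).
Qed.

Variables (K : kernel H) (K_inv : invariant_kernel eqH K).
Variable RK : forall s : symbol G, rkhs (fibre_kernel a K s).

(** This is [K_(g.x) h], the image of [K_x h] that the representation has to
    take. *)
Definition push_ker s t (g : hom s t) (x : fibre a s) (h : H (sval x)) : RK t :=
  rk_ker (RK t) (x := fibre_act g x) (hcast (esym (eqH (fibre_dom g x))) h).

(** Invariance is used for the arrow [g^*] from [y]: it moves [g^*] in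
    [K(g^* . y, x)] to the second argument as [g^** = g]. *)
Lemma sec_push_ker s t (g : hom s t) (x : fibre a s) (h : H (sval x)) y :
  rk_sec (RK t) (push_ker g h) y =
  pull (hom_star g) (rk_sec (RK s) (rk_ker (RK s) h)) y.
Proof.
rewrite rk_kerE /pull rk_kerE.
have gx : cod (star g) = anchor a (sval x).
  by rewrite cod_star (hom_dom g) (svalP x).
have := K_inv (fibre_dom (hom_star g) y) gx h.
rewrite /fibre_kernel /= => ->.
(* The two sides now differ by the base points [g^** . x] and [g . x]. *)
apply: (hcast_arg (fun z => K (sval y) z)).
by rewrite star_star.
Qed.

Lemma dot_push_ker s t (g : hom s t) (x : fibre a s) (h : H (sval x))
    (f : RK t) :
  '[< f, push_ker g h >] = '[< pull g (rk_sec (RK t) f) x, h >].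
Proof. by rewrite -rk_reproducing /pull hcast_dot. Qed.

(** The adjoint formula is proved in the same induction as the existence of the
    translate [v].  It is stated for arbitrary elements [f], [f'] outside the
    spans, related through their sections only, so that it makes sense before
    the translation operators are defined. *)
Lemma translate_exists s t (g : hom s t) (u : RK s) : ker_span (RK s) u ->
  exists v : RK t, [/\ ker_span (RK t) v,
    forall y, rk_sec (RK t) v y = pull (hom_star g) (rk_sec (RK s) u) y &
    forall (f : RK t) (f' : RK s),
      (forall x, rk_sec (RK s) f' x = pull g (rk_sec (RK t) f) x) ->
      '[< f', u >] = '[< f, v >]].
Proof.
move: u; apply: lin_span_ind => [|c _ u [x [h ->]] _ [v [Dv vE v_adj]]].
  exists 0; split=> [|y|f f' _]; first exact: lin_span0.
    by rewrite /pull !rk_sec0 hcast0.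
  by rewrite !linear0r.
exists (c *: push_ker g h + v); split=> [|y|f f' f'E].
- apply: lin_span_linear Dv.
  by exists (fibre_act g x), (hcast (esym (eqH (fibre_dom g x))) h).
- by rewrite rk_sec_linear sec_push_ker vE /pull rk_sec_linear hcast_linear.
- by rewrite !linearPr /= (v_adj _ _ f'E) dot_push_ker -f'E rk_reproducing.
Qed.

(** The choice of a witness is harmless, as an element of [RK t] is determined by
    its section. *)
Definition translate s t (g : hom s t) (u : {f : RK s | ker_span (RK s) f}) :
    RK t :=
  sval (cid (translate_exists g (svalP u))).

Lemma translate_span s t (g : hom s t) u : ker_span (RK t) (translate g u).
Proof. by rewrite /translate; case: cid => v []. Qed.

Lemma sec_translate s t (g : hom s t) u y :
  rk_sec (RK t) (translate g u) y =
  pull (hom_star g) (rk_sec (RK s) (sval u)) y.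
Proof. by rewrite /translate; case: cid => v []. Qed.

Lemma translate_adjoint s t (g : hom s t) (w : {f : RK t | ker_span (RK t) f}) :
  adjoint_at (translate g) (sval w) (translate (hom_star g) w).
Proof.
move=> u; rewrite [translate (hom_star g) w]/translate.
by case: cid => v [_ _] /= adj; apply: adj; exact: sec_translate.
Qed.

Lemma translate_linear s t (g : hom s t) c
    (u v w : {f : RK s | ker_span (RK s) f}) :
  sval w = c *: sval u + sval v ->
  translate g w = c *: translate g u + translate g v.
Proof.
move=> wE; apply: rk_sec_inj => y.
by rewrite rk_sec_linear !sec_translate wE /pull rk_sec_linear hcast_linear.
Qed.

Lemma translate_ker s t (g : hom s t) (x : fibre a s) (h : H (sval x)) :
  translate g (ker_in_span (RK s) h) = push_ker g h.
Proof. by apply: rk_sec_inj => y; rewrite sec_translate sec_push_ker. Qed.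

Lemma translate_mul s t r (g : hom t r) (h : hom s t) u v :
  sval v = translate h u -> translate (hom_mul g h) u = translate g v.
Proof.
move=> vE; apply: rk_sec_inj => y.
rewrite !sec_translate vE hom_star_mul pull_mul /pull.
by rewrite sec_translate.
Qed.

Lemma translate_adjoint_dom s t (g : hom s t) :
  ker_span (RK t) `<=` adjoint_dom (translate g).
Proof.
move=> w Dw; exists (translate (hom_star g) (exist _ w Dw)).
exact: (translate_adjoint g (exist _ w Dw)).
Qed.

Lemma translate_adjoint_maps s t (g : hom s t) w v :
  ker_span (RK t) w -> adjoint_at (translate g) w v -> ker_span (RK s) v.
Proof.
move=> Dw Tv.
rewrite (adjoint_at_inj Tv (translate_adjoint g (exist _ w Dw))).
exact: translate_span.
Qed.

Definition translation s t (g : hom s t) :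
    Lstar (ker_span (RK s)) (ker_span (RK t)) :=
  MkLstar (@translate_linear s t g) (@translate_span s t g)
    (@translate_adjoint_dom s t g) (@translate_adjoint_maps s t g).

(** Translations are defined along arrows of any declared ends, so restricting
    the family to the arrows [hom_of g] and casting back gives nothing new. *)
Lemma rep_on_translation s t (g : hom s t) :
  rep_on (D := fun s => ker_span (RK s)) (fun g => translation (hom_of g)) g =
  translation g.
Proof. by case: g => g gs gt; case: s / gs; case: t / gt. Qed.

End Translation.

Theorem theorem3p11 (R : realType) (k : scalar_kind)
    (G : star_semigroupoid) (X : Type) (a : left_action G X)
    (H : X -> hilbert R k) (K : kernel H)
    (eqH : invariant_bundle a H)
    (K_inv : invariant_kernel eqH K)
    (K_psd : partially_psd a K)
    (RK : forall s : symbol G, rkhs (fibre_kernel a K s)) :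
  let D := fun s : symbol G => ker_span (RK s) in
  exists! Phi : rep_map D,
    generalised_star_rep Phi /\
    forall (g : G) (x : fibre a (dom g)) (h : H (sval x)),
      rk_ker (RK (cod g)) (x := fibre_act (hom_of g) x)
        (hcast (esym (eqH g (sval x) (fibre_dom (hom_of g) x))) h) =
      Phi g (ker_in_span (RK (dom g)) h).
Proof.
move=> D; exists (fun g => translation K_inv RK (hom_of g)).
split=> [|Phi [_ Phi_ker]].
  split=> [|g x h]; last by rewrite /= translate_ker.
  split=> [s t r g h u|s t g w]; rewrite !rep_on_translation.
    exact: translate_mul.
  exact: translate_adjoint.
apply: functional_extensionality_dep => g.
apply: (Lstar_ext_span (erefl _)) => -[u Du] /= [x [h uE]].
have -> : exist _ u Du = ker_in_span (RK (dom g)) h by exact: eq_exist.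
by rewrite -Phi_ker /= translate_ker.
Qed.
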